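(* Let $\Omega$ be a domain in $\mathbb{R}^n$ ($n\geq 2$), let $u$ be an upper semicontinuous function on $\Omega$, let $v$ be a subharmonic function in $\Omega$, and let $K$ be a Borel subset of $\Omega$. Let $h:(0,+\infty)\to(0,+\infty)$ be a function such that there are real numbers $M>0$ and $c>4$ satisfying $$\int_0^{c\epsilon}\frac{h(r)}{r^{n-1}}\,dr\leq M\frac{h(\epsilon)}{\epsilon^{n-2}}$$ for all sufficiently small $\epsilon>0$. Suppose that there exist a positive Borel measure $\mu$, real numbers $A,B>0$, $\epsilon_0>0$, and a set $N\subset K$ such that: 1. $\mu(N)=0$; 2. $A\,h(\epsilon)\leq\mu\big(K\cap\mathbb{B}(x,\epsilon)\big)\leq B\,h(\epsilon)$ for all $x\in K$ and all $\epsilon<\epsilon_0$; 3. $u\geq v$ on $K\setminus N$. Then $u\geq v$ on $K$.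
   Context: $\mathbb{B}(x,r)$ denotes the open ball in $\mathbb{R}^n$ with center $x$ and radius $r$. A function $v:\Omega\to[-\infty,+\infty)$ is subharmonic if it is upper semicontinuous, not identically $-\infty$, and for every relatively compact open $G\subset\Omega$ and every $\varphi$ harmonic on $G$ and continuous on $\bar G$, $v\leq\varphi$ on $\partial G$ implies $v\leq\varphi$ on $G$. *)

(* Defs.v *)
(* R^n is modelled as 'rV[R]_n (R : realType);
   its canonical topology is the product topology = Euclidean topology. *)
From HB Require Import structures.
From mathcomp Require Import all_boot all_order all_algebra.
From mathcomp Require Import all_classical all_reals all_analysis.
Set Implicit Arguments. Unset Strict Implicit. Unset Printing Implicit Defensive.
Import Order.TTheory GRing.Theory Num.Theory.
Import numFieldNormedType.Exports.
Local Open Scope classical_set_scope.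
Local Open Scope ring_scope.

Section Defs.
Context {R : realType} {n : nat}.
Local Notation V := 'rV[R]_n.

Definition euclid_norm (x : V) : R := Num.sqrt (\sum_(i < n) x ord0 i ^+ 2).
Definition eball (x : V) (r : R) : set V := [set y | euclid_norm (y - x) < r].

Definition domain (O : set V) : Prop := open O /\ connected O /\ O !=set0.

Definition usc_on (O : set V) (u : V -> \bar R) : Prop :=
  forall x, O x -> forall a : R, (u x < a%:E)%E ->
    \forall y \near x, (u y < a%:E)%E.

Definition unit_vec (i : 'I_n) : V := \row_(j < n) (i == j)%:R.
Definition laplacian (f : V -> R) (x : V) : R :=
  \sum_(i < n) 'D_(unit_vec i) ('D_(unit_vec i) f) x.

Definition C2_on (G : set V) (f : V -> R) : Prop :=
  (forall x, G x -> differentiable f x) /\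
  (forall i x, G x -> differentiable ('D_(unit_vec i) f) x) /\
  (forall i j x, G x ->
     {for x, continuous ('D_(unit_vec j) ('D_(unit_vec i) f))}).

Definition harmonic_on (G : set V) (f : V -> R) : Prop :=
  C2_on G f /\ forall x, G x -> laplacian f x = 0.

Definition subharmonic_on (O : set V) (v : V -> \bar R) : Prop :=
  [/\ usc_on O v,
      (forall x, O x -> v x != +oo%E),
      (exists2 x, O x & v x != -oo%E) &
      forall G : set V, open G -> compact (closure G) -> closure G `<=` O ->
        forall phi : V -> R, harmonic_on G phi ->
          {within closure G, continuous phi} ->
          (forall x, (closure G `\` G) x -> (v x <= (phi x)%:E)%E) ->
          forall x, G x -> (v x <= (phi x)%:E)%E].

End Defs.

Definition borelV (R : realType) (n : nat) := g_sigma_algebraType (@open 'rV[R]_n).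
Definition borel_set {R : realType} {n : nat} (A : set 'rV[R]_n) : Prop :=
  measurable (A : set (borelV R n)).

(* Main.v *)
(* Suppose u < a < b = v at a point x0 of N.  Near x0, v < b + eta, and v < a on
   an open set U that carries almost all of the mass of mu on K close to x0.
   Discretise mu on a part L of K inside U and within eps of x0, at positive
   distance from the complement of U, into finitely many point masses, and
   compare v, on the ball of radius 4 eps deprived of tiny balls around these
   poles, with b + eta - l p, where p is the Newtonian (n = 2: logarithmic)
   potential of the masses, normalised to be <= 0 on the sphere.  The upper mass
   bound and the integral hypothesis, turned into a dyadic sum, give
   p <= C h(eps) / eps^(n-2) next to the poles, while the lower mass bound gives
   p x0 >= c' h(eps) / eps^(n-2), with C and c' independent of eps.  The maximum
   principle with l = (b - a) eps^(n-2) / (C h(eps)) then yields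
   b <= b + eta - (b - a) c' / C, which is false for small eta. *)
Require Import Defs.
From HB Require Import structures.
From mathcomp Require Import all_boot all_order all_algebra.
From mathcomp Require Import all_classical all_reals all_analysis.
From mathcomp Require Import measurable_realfun.
From mathcomp Require Import ring lra.
Set Implicit Arguments. Unset Strict Implicit.
Unset Printing Implicit Defensive.
Import Order.TTheory GRing.Theory Num.Theory.
Import numFieldNormedType.Exports.
Local Open Scope classical_set_scope.
Local Open Scope ring_scope.

(** * Euclidean norm and balls on row vectors *)

Section EuclideanNorm.
Context {R : realType} {n : nat}.
Implicit Types (x y z : 'rV[R]_n) (r : R).

Lemma euclid_norm_ge0 x : 0 <= euclid_norm x.
Proof. exact: sqrtr_ge0. Qed.

Lemma euclid_norm_sqr x : euclid_norm x ^+ 2 = \sum_(i < n) x ord0 i ^+ 2.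
Proof. by rewrite sqr_sqrtr// sumr_ge0// => i _; rewrite sqr_ge0. Qed.

Lemma euclid_norm0 : euclid_norm (0 : 'rV[R]_n) = 0.
Proof.
by rewrite /euclid_norm big1 ?sqrtr0// => i _; rewrite mxE expr0n.
Qed.

Lemma euclid_normN x : euclid_norm (- x) = euclid_norm x.
Proof. by congr Num.sqrt; apply: eq_bigr => i _; rewrite mxE sqrrN. Qed.

Lemma euclid_distC x y : euclid_norm (x - y) = euclid_norm (y - x).
Proof. by rewrite -euclid_normN opprB. Qed.

Lemma coord_le_euclid_norm x i : `|x ord0 i| <= euclid_norm x.
Proof.
rewrite -(@ler_pXn2r _ 2)// ?nnegrE ?euclid_norm_ge0//.
rewrite euclid_norm_sqr real_normK ?num_real// (bigD1 i)//= lerDl.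
by apply: sumr_ge0 => j _; rewrite sqr_ge0.
Qed.

Lemma euclid_norm_eq0 x : euclid_norm x = 0 -> x = 0.
Proof.
move=> x0; apply/rowP => i; rewrite mxE; apply/eqP.
by rewrite -normr_le0 -x0 coord_le_euclid_norm.
Qed.

Lemma euclid_norm_gt0 x : x != 0 -> 0 < euclid_norm x.
Proof.
move=> x0; rewrite lt_def euclid_norm_ge0 andbT.
by apply: contra x0 => /eqP/euclid_norm_eq0 ->.
Qed.

Lemma euclid_cauchy_schwarz x y :
  \sum_(i < n) x ord0 i * y ord0 i <= euclid_norm x * euclid_norm y.
Proof.
have [->|x0] := eqVneq x 0.
  by rewrite euclid_norm0 mul0r big1// => i _; rewrite mxE mul0r.
have [->|y0] := eqVneq y 0.
  by rewrite euclid_norm0 mulr0 big1// => i _; rewrite mxE mulr0.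
set a := euclid_norm x; set b := euclid_norm y.
have a0 : 0 < a by exact: euclid_norm_gt0.
have b0 : 0 < b by exact: euclid_norm_gt0.
(* Weighted arithmetic-geometric mean: with weights [b / a] and [a / b] the right-hand sides add up
   to exactly [a * b]. *)
have H i : x ord0 i * y ord0 i <=
    2^-1 * ((b / a) * x ord0 i ^+ 2 + (a / b) * y ord0 i ^+ 2).
  rewrite -subr_ge0.
  have -> : 2^-1 * ((b / a) * x ord0 i ^+ 2 + (a / b) * y ord0 i ^+ 2)
    - x ord0 i * y ord0 i =
    (2 * a * b)^-1 * (b * x ord0 i - a * y ord0 i) ^+ 2.
    by field; rewrite !gt_eqF.
  by rewrite mulr_ge0 ?sqr_ge0// invr_ge0 !mulr_ge0// ltW.
apply: (le_trans (ler_sum _ (fun i _ => H i))).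
rewrite -mulr_sumr big_split /= -!mulr_sumr -!euclid_norm_sqr -/a -/b.
by rewrite le_eqVlt; apply/orP; left; apply/eqP; field; rewrite !gt_eqF.
Qed.

Lemma euclid_normD x y : euclid_norm (x + y) <= euclid_norm x + euclid_norm y.
Proof.
rewrite -(@ler_pXn2r _ 2)// ?nnegrE ?addr_ge0 ?euclid_norm_ge0//.
rewrite euclid_norm_sqr.
under eq_bigr do rewrite mxE sqrrD.
rewrite !big_split /= -!euclid_norm_sqr sqrrD lerD2r lerD2l.
by rewrite mulr2n lerD// euclid_cauchy_schwarz.
Qed.

Lemma euclid_dist_triangle z x y :
  euclid_norm (x - y) <= euclid_norm (x - z) + euclid_norm (z - y).
Proof. by rewrite -[x - y](subrKA z) euclid_normD. Qed.

Lemma euclid_norm_continuous : continuous (@euclid_norm R n).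
Proof.
move=> x; apply: continuous_comp; last exact: sqrt_continuous.
apply: continuous_big => [|i _ {}x]; first exact: add_continuous.
apply: (@continuous_comp _ _ _ (fun y : 'rV[R]_n => y ord0 i)
  (fun t : R => t ^+ 2)); first exact: coord_continuous.
exact: exprn_continuous.
Qed.

Lemma euclid_dist_continuous x : continuous (fun y => euclid_norm (y - x)).
Proof.
move=> y; apply: (@continuous_comp _ _ _ (fun y => y - x) (@euclid_norm R n)).
  by apply: (@cvgB _ _ _ (nbhs y) _ id (cst x)); [exact: cvg_id|exact: cvg_cst].
exact: euclid_norm_continuous.
Qed.

Lemma eball_open x r : open (eball x r).
Proof.
rewrite (_ : eball x r = (fun y =>
  euclid_norm (y - x)) @^-1` [set t | t < r])//.
by apply: open_comp => [y _|]; [exact: euclid_dist_continuous|exact: open_lt].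
Qed.

Lemma eball_center x r : 0 < r -> eball x r x.
Proof. by move=> r0; rewrite /eball/= subrr euclid_norm0. Qed.

Lemma closed_eball_closed x r : closed [set y | euclid_norm (y - x) <= r].
Proof.
rewrite (_ : mkset _ = (fun y => euclid_norm (y - x)) @^-1` [set t | t <= r])//.
by apply: closed_comp => [y _|];
  [exact: euclid_dist_continuous|exact: closed_le].
Qed.

(** The ambient norm is the maximum of the coordinates; this comparison carries compactness and
    neighbourhoods over to Euclidean balls. *)
Lemma norm_le_euclid_norm x : `|x| <= euclid_norm x.
Proof.
rewrite [leLHS]/Num.Def.normr /= mx_normrE; apply/bigmax_leP; split=> [|ij _].
  exact: euclid_norm_ge0.
by rewrite (ord1 ij.1) coord_le_euclid_norm.
Qed.

Lemma closed_eball_compact x r : compact [set y | euclid_norm (y - x) <= r].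
Proof.
apply: bounded_closed_compact; last exact: closed_eball_closed.
exists (`|x| + r); split; first exact: num_real.
move=> M xrM y /= yx; apply/ltW/(le_lt_trans _ xrM).
rewrite -[y](subrK x) addrC (le_trans (ler_normD _ _))// lerD2l.
exact: le_trans (norm_le_euclid_norm _) yx.
Qed.

Lemma nbhs_eball x (A : set 'rV[R]_n) :
  nbhs x A -> exists2 r, 0 < r & eball x r `<=` A.
Proof.
move=> /nbhs_ballP[r r0 rA]; exists r => // y yx; apply: rA.
rewrite -ball_normE /ball_/= distrC.
exact: le_lt_trans (norm_le_euclid_norm _) yx.
Qed.

Lemma subset_eball x r s : r <= s -> eball x r `<=` eball x s.
Proof. by move=> rs y /lt_le_trans; apply. Qed.

End EuclideanNorm.

(** * Differentiability is a local property *)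

Section NearDifferentiable.
Context {R : realType} {V W : normedModType R}.
Implicit Types (f g : V -> W) (x v : V).

Lemma near_eq_differentiable f g x :
  (\near x, f x = g x) -> differentiable f x -> differentiable g x.
Proof.
move=> fg dfx; have fgx : f x = g x := nbhs_singleton fg.
have [cdf /eqaddoP df] := (diff_locallyP x f).1 dfx.
have dg : g \o shift x = cst (g x) + 'd f x +o_ 0 id.
  apply/eqaddoP => e e0; near=> h.
  have gh : f (h + x) = g (h + x).
    near: h; move: fg; rewrite (near_shift 0) /=.
    by apply: filterS => y /=; rewrite subr0.
  have : `|(f \o shift x - (cst (f x) + 'd f x)) h| <= e * `|h|.
    by near: h; exact: df.
  by rewrite !fctE /= gh fgx.
have dgf : 'd g x = 'd f x :> (V -> W) by exact: diff_unique.
by apply/diff_locallyP; rewrite dgf.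
Unshelve. all: by end_near. Qed.

Lemma open_near {T : topologicalType} (G : set T) (P : T -> Prop) (x : T) :
  open G -> G x -> (forall y, G y -> P y) -> \forall y \near x, P y.
Proof.
move=> oG Gx GP; have : nbhs x G by exact: open_nbhs_nbhs.
exact: filterS.
Qed.

End NearDifferentiable.

(** * Closure properties of harmonic functions *)

Section Harmonic.
Context {R : realType} {n : nat}.
Local Notation V := 'rV[R]_n.
Implicit Types (G : set V) (f g : V -> R) (i j : 'I_n).

(** Closed formulas for the derivatives hold only on [G], whereas the iterated derivatives in
    [C2_on] are global functions. As [G] is open, the two agree near each of its points, which
    transfers differentiability and continuity. *)
Lemma harmonic_on_witness G f (f1 : 'I_n -> V -> R)
  (f2 : 'I_n -> 'I_n -> V -> R) :
  open G ->
  (forall x, G x -> differentiable f x) ->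
  (forall i x, G x -> 'D_(unit_vec i) f x = f1 i x) ->
  (forall i x, G x -> differentiable (f1 i) x) ->
  (forall i j x, G x -> 'D_(unit_vec j) (f1 i) x = f2 i j x) ->
  (forall i j x, G x -> {for x, continuous (f2 i j)}) ->
  (forall x, G x -> \sum_i f2 i i x = 0) ->
  harmonic_on G f.
Proof.
move=> oG df Df df1 Df1 cf2 f20.
have Df2 i j x : G x -> 'D_(unit_vec j) ('D_(unit_vec i) f) x = f2 i j x.
  move=> Gx; rewrite -Df1//; apply: near_eq_derive.
  by refine (open_near oG Gx _) => y; exact: Df.
split; [split=> //; split|].
- move=> i x Gx; apply: near_eq_differentiable (df1 i x Gx).
  by refine (open_near oG Gx _) => y Gy; rewrite Df.
- move=> i j x Gx; rewrite /prop_for /continuous_at Df2//.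
  apply: cvg_trans (cf2 i j x Gx); apply: near_eq_cvg; first exact: nbhs_filter.
  by refine (open_near oG Gx _) => y Gy; rewrite Df2.
- move=> x Gx; rewrite /laplacian -[RHS](f20 x Gx).
  by apply: eq_bigr => i _; exact: Df2.
Qed.

Lemma harmonic_on_cst G (a : R) : open G -> harmonic_on G (cst a : V -> R).
Proof.
move=> oG.
apply: (@harmonic_on_witness _ _ (fun=> cst 0) (fun _ _ => cst 0)) => //.
- by move=> i x _; rewrite derive_cst.
- by move=> i j x _; rewrite derive_cst.
- by move=> i j x _; exact: cst_continuous.
- by move=> x _; rewrite big1.
Qed.

Lemma harmonic_onD G f g : open G -> harmonic_on G f -> harmonic_on G g ->
  harmonic_on G (f + g).
Proof.
move=> oG [[df [ddf cf]] lf] [[dg [ddg cg]] lg].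
apply: (@harmonic_on_witness _ _
  (fun i => 'D_(unit_vec i) f + 'D_(unit_vec i) g)
  (fun i j => 'D_(unit_vec j) ('D_(unit_vec i) f) +
              'D_(unit_vec j) ('D_(unit_vec i) g))) => //.
- by move=> x Gx; apply: differentiableD; [exact: df|exact: dg].
- move=> i x Gx; rewrite deriveD//; apply: diff_derivable.
  + exact: df.
  + exact: dg.
- by move=> i x Gx; apply: differentiableD; [exact: ddf|exact: ddg].
- move=> i j x Gx; rewrite deriveD//; apply: diff_derivable.
  + exact: ddf.
  + exact: ddg.
- by move=> i j x Gx; exact: continuousD (cf i j x Gx) (cg i j x Gx).
- by move=> x Gx; rewrite big_split/= [X in X + _](lf x Gx) [X in _ + X](lg x
    Gx) addr0.
Qed.

Lemma harmonic_onZ G (a : R) f : open G -> harmonic_on G f ->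
  harmonic_on G (a *: f).
Proof.
move=> oG [[df [ddf cf]] lf].
apply: (@harmonic_on_witness _ _
  (fun i => a *: 'D_(unit_vec i) f)
  (fun i j => a *: 'D_(unit_vec j) ('D_(unit_vec i) f))) => //.
- by move=> x Gx; apply: differentiableZ; exact: df.
- by move=> i x Gx; rewrite deriveZ//; apply: diff_derivable; exact: df.
- by move=> i x Gx; apply: differentiableZ; exact: ddf.
- by move=> i j x Gx; rewrite deriveZ//; apply: diff_derivable; exact: ddf.
- by move=> i j x Gx; exact: continuousZl_tmp (cf i j x Gx).
- by move=> x Gx; rewrite -scaler_sumr [X in _ *: X](lf x Gx) scaler0.
Qed.

Lemma harmonic_on_sum G m (F : 'I_m -> V -> R) : open G ->
  (forall k, harmonic_on G (F k)) -> harmonic_on G (\sum_(k < m) F k).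
Proof.
move=> oG; elim/big_ind : _ => //.
- by move=> _; exact: (harmonic_on_cst 0 oG).
- by move=> f g hf hg hF; apply: harmonic_onD => //; [exact: hf|exact: hg].
Qed.

End Harmonic.

(** * Differentiation of radial functions *)

Section Radial.
Context {R : realType} {n : nat}.
Local Notation V := 'rV[R]_n.
Implicit Types (x y v : V) (i j : 'I_n) (phi : R -> R).

Lemma is_derive_coord x v i : is_derive x v (fun z : V => z ord0 i) (v ord0 i).
Proof.
have did : derivable (id : V -> V) x v by exact: derivable_id.
apply: DeriveDef; first exact/diff_derivable/differentiable_coord.
have := congr1 (fun M : V => M ord0 i) (derive_mx did).
by rewrite derive_id mxE.
Qed.

Lemma is_derive_coordB x y v i :
  is_derive x v (fun z : V => (z - y) ord0 i) (v ord0 i).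
Proof.
rewrite (_ : (fun z : V => (z - y) ord0 i) =
  (fun z : V => z ord0 i) - cst (y ord0 i)); last first.
  by apply/funext => z; rewrite !fctE !mxE.
rewrite -[v ord0 i]subr0.
by apply: is_deriveB; exact: is_derive_coord.
Qed.

Lemma differentiable_coordB x y i :
  differentiable (fun z : V => (z - y) ord0 i) x.
Proof.
rewrite (_ : (fun z : V => (z - y) ord0 i) =
  (fun z : V => z ord0 i) - cst (y ord0 i)); last first.
  by apply/funext => z; rewrite !fctE !mxE.
by apply: differentiableB; [exact: differentiable_coord|exact:
  differentiable_cst].
Qed.

(** Radial functions are differentiated through this polynomial, so that the square root is only
    differentiated at positive numbers. *)
Let sqdist y (z : V) := \sum_(i < n) (z - y) ord0 i ^+ 2.

Let sqdistE y : sqdist y = \sum_(i < n) (fun z : V => (z - y) ord0 i) ^+ 2.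
Proof. by apply/funext => z; rewrite /sqdist fct_sumE; apply: eq_bigr. Qed.

Let differentiable_sqdist y x : differentiable (sqdist y) x.
Proof.
rewrite sqdistE; apply: differentiable_sum => i.
exact/differentiableX/differentiable_coordB.
Qed.

Let derive_sqdist y x v :
  'D_v (sqdist y) x = 2 * \sum_(i < n) (x - y) ord0 i * v ord0 i.
Proof.
rewrite sqdistE; apply: derive_val.
rewrite mulr_sumr; apply: is_derive_sum => i.
apply: (is_derive_eq (@is_deriveX _ _ _ 2 x v _ (is_derive_coordB x y v i))).
by rewrite expr1 /GRing.scale/= mulrA.
Qed.

Section Chain.
Variables (phi : R -> R) (dphi : R) (x y : V).
Hypothesis xy : x != y.
Hypothesis dphiP : is_derive (euclid_norm (x - y)) 1 phi dphi.

Let normxy_gt0 : 0 < euclid_norm (x - y).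
Proof. by apply: euclid_norm_gt0; rewrite subr_eq0. Qed.

Let is_derive_sqrt_comp : is_derive (sqdist y x) 1 (phi \o Num.sqrt)
  (dphi * (2 * euclid_norm (x - y))^-1).
Proof.
have q0 : 0 < sqdist y x by rewrite -sqrtr_gt0.
have h1 := is_derive1_sqrt q0.
exact: is_derive1_comp dphiP h1.
Qed.

Lemma differentiable_radial :
  differentiable (fun z => phi (euclid_norm (z - y))) x.
Proof.
apply: (@differentiable_comp _ _ _ _ (sqdist y) (phi \o Num.sqrt)) => //.
by apply/derivable1_diffP; case: is_derive_sqrt_comp.
Qed.

Lemma derive_radial i : 'D_(unit_vec i) (fun z => phi (euclid_norm (z - y))) x =
  dphi * ((x - y) ord0 i / euclid_norm (x - y)).
Proof.
rewrite deriveE; last exact: differentiable_radial.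
have dpsi : differentiable (phi \o Num.sqrt) (sqdist y x).
  by apply/derivable1_diffP; case: is_derive_sqrt_comp.
rewrite (@diff_comp _ _ _ _ (sqdist y) (phi \o Num.sqrt))//= diff1E//.
rewrite -deriveE// derive_sqdist derive1E (@derive_val _ _ _ _ _ _ _
  is_derive_sqrt_comp).
rewrite (bigD1 i)//= big1 => [|j ji];
  last by rewrite [X in _ * X]mxE eq_sym (negbTE ji) mulr0.
rewrite [unit_vec i ord0 i]mxE eqxx mulr1 addr0 /GRing.scale/=.
by field; rewrite gt_eqF.
Qed.

End Chain.

End Radial.

(** * The Newtonian kernel: increments and harmonicity *)

Section NewtonKernel.
Context {R : realType}.

(* The radial profile of the fundamental solution, normalised so that its
   derivative is -r^(1-n) in every dimension n >= 2. *)
Definition newton (n : nat) (r : R) : R :=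
  if (n == 2)%N then - ln r else (r ^+ (n - 2))^-1 / (n - 2)%:R.

Lemma is_derive_exprV m (r : R) : 0 < r ->
  is_derive r 1 (fun t => (t ^+ m)^-1) (- m%:R * (r ^+ m.+1)^-1).
Proof.
move=> r0.
have exprmE : (fun t : R => t ^+ m) = id ^+ m by apply/funext => t;
  rewrite exprfctE.
rewrite (_ : (fun t : R => _) = fun t => ((id ^+ m) t)^-1);
  last by rewrite -exprmE.
have rm0 : (id ^+ m) r != 0 by rewrite -exprmE expf_neq0// gt_eqF.
apply: (is_derive_eq (is_deriveV rm0 (@is_deriveX _ _ id m r 1 1
  (is_derive_id r 1)))).
rewrite -exprmE /GRing.scale/= mulr1; case: m {exprmE rm0} => [|m].
  by rewrite mul0r mulr0 oppr0 mul0r.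
by rewrite /= !exprS; field; rewrite ?gt_eqF ?exprn_gt0.
Qed.

Lemma is_derive_newton n (r : R) : (2 <= n)%N -> 0 < r ->
  is_derive r 1 (newton n) (- (r ^+ n.-1)^-1).
Proof.
move=> n2 r0; have [nE|nn2] := eqVneq n 2%N.
  rewrite nE (_ : newton 2 = - (@ln R))//.
  by apply: is_deriveN; rewrite expr1; exact: is_derive1_ln.
rewrite (_ : newton n = fun t => (t ^+ (n - 2))^-1 / (n - 2)%:R); last first.
  by apply/funext => t; rewrite /newton (negbTE nn2).
have m0 : (n - 2)%:R != 0 :> R by rewrite pnatr_eq0 subn_eq0 -ltnNge
  ltn_neqAle eq_sym nn2.
rewrite (_ : (fun t => _) = (n - 2)%:R^-1 *: (fun t : R =>
  (t ^+ (n - 2))^-1)); last first.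
  by apply/funext => t; rewrite fctE mulrC.
apply: (is_derive_eq (@is_deriveZ _ _ _ _ _ r 1 _
  (is_derive_exprV (n - 2) r0))).
rewrite /GRing.scale/= !mulNr mulrN mulKf//.
by case: n n2 {nn2 m0} => // -[]// n _; rewrite subn2.
Qed.

(** Mean value theorem: the increment is [(s - r) / t ^+ n.-1] for some [t] between [r] and [s]. The
    logarithmic case needs no separate treatment. *)
Lemma newtonB_bounds n (r s : R) : (2 <= n)%N -> 0 < r -> r <= s ->
  (s - r) * (s ^+ n.-1)^-1 <= newton n r - newton n s
    <= (s - r) * (r ^+ n.-1)^-1.
Proof.
move=> n2 r0 rs.
have cN : {within `[r, s], continuous (newton n)}.
  apply: derivable_within_continuous => t; rewrite in_itv/= => /andP[rt _].
  by case: (is_derive_newton n2 (lt_le_trans r0 rt)).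
have [t /andP[]] : exists2 t, r <= t <= s &
    newton n r - newton n s = (s - r) * (t ^+ n.-1)^-1.
  have dN t : t \in `]r, s[ -> is_derive t 1 (newton n) (- (t ^+ n.-1)^-1).
    by rewrite in_itv/= => /andP[rt _]; apply/is_derive_newton/(lt_trans r0 rt).
  have [t] := MVT_segment rs dN cN.
  rewrite in_itv/= => rts H; exists t => //.
  by rewrite -opprB H mulNr opprK mulrC.
move=> rt ts ->; have t0 := lt_le_trans r0 rt.
have s0 := lt_le_trans t0 ts.
by apply/andP; split; rewrite ler_wpM2l ?subr_ge0// lef_pV2 ?posrE ?exprn_gt0//;
  rewrite lerXn2r// nnegrE ltW.
Qed.

Lemma newton_le n (r s : R) : (2 <= n)%N -> 0 < r -> r <= s ->
  newton n s <= newton n r.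
Proof.
move=> n2 r0 rs; have /andP[h _] := newtonB_bounds n2 r0 rs.
rewrite -subr_ge0 (le_trans _ h)// mulr_ge0 ?subr_ge0// invr_ge0 exprn_ge0//.
exact: le_trans (ltW r0) rs.
Qed.

(** With [c = x - y] and [r] its norm, the gradient is [- c_i / r^n] and the Hessian
    [n c_i c_j / r^(n+2) - delta_ij / r^n]; the trace vanishes because the [c_i^2] add up to
    [r^2]. *)
Lemma harmonic_on_newton n (G : set 'rV[R]_n) (y : 'rV[R]_n) :
  (2 <= n)%N -> open G -> ~ G y ->
  harmonic_on G (fun x => newton n (euclid_norm (x - y))).
Proof.
move=> n2 oG nGy.
have n0 : (0 < n)%N by exact: leq_trans n2.
have Gneq x : G x -> x != y by move=> Gx; apply/eqP => xy; apply: nGy;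
  rewrite -xy.
have Gpos x : G x -> 0 < euclid_norm (x - y).
  by move=> Gx; apply: euclid_norm_gt0; rewrite subr_eq0 Gneq.
pose psi m (x : 'rV[R]_n) := (euclid_norm (x - y) ^+ m)^-1.
pose c i (x : 'rV[R]_n) := (x - y) ord0 i.
have dpsi m x : G x -> differentiable (psi m) x.
  move=> Gx; apply: (@differentiable_radial _ _ (fun t => (t ^+ m)^-1) _ x y).
  - exact: Gneq.
  - exact: is_derive_exprV (Gpos _ Gx).
have Dpsi m i x : G x -> 'D_(unit_vec i) (psi m) x = - m%:R * psi m.+2 x * c i
  x.
  move=> Gx.
  rewrite (@derive_radial _ _ (fun t =>
    (t ^+ m)^-1) _ x y (Gneq _ Gx) (is_derive_exprV m (Gpos _ Gx))).
  rewrite /psi -/(c i x); have := Gpos _ Gx; set r := euclid_norm _ => r0.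
  by rewrite !exprS; field; rewrite ?gt_eqF ?exprn_gt0.
pose f1 i (x : 'rV[R]_n) := - (psi n x * c i x).
pose f2 i j (x : 'rV[R]_n) :=
  n%:R * psi n.+2 x * c i x * c j x - psi n x * (i == j)%:R.
have f1E i : f1 i = - (psi n * c i) by [].
apply: (@harmonic_on_witness _ _ _ _ f1 f2) => //.
- move=> x Gx; apply: (differentiable_radial (Gneq _ Gx)).
  exact: is_derive_newton (Gpos _ Gx).
- move=> i x Gx; rewrite (derive_radial (Gneq _ Gx) (is_derive_newton n2 (Gpos
    _ Gx))).
  rewrite /f1 /psi -/(c i x); have := Gpos _ Gx; set r := euclid_norm _ => r0.
  rewrite -(prednK n0) exprS /=.
  by field; rewrite ?gt_eqF ?exprn_gt0.
- move=> i x Gx; rewrite f1E; apply: differentiableN; apply: differentiableM.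
    exact: dpsi.
  exact: differentiable_coordB.
- move=> i j x Gx; rewrite f1E deriveN; last first.
    apply/diff_derivable/differentiableM; first exact: dpsi.
    exact: differentiable_coordB.
  rewrite deriveM;
    [|exact/diff_derivable/dpsi|exact/diff_derivable/differentiable_coordB].
  rewrite Dpsi// (@derive_val _ _ _ _ _ _ _ (is_derive_coordB x y (unit_vec j)
    i)) mxE.
  rewrite /f2 /GRing.scale/= eq_sym; ring.
- move=> i j x Gx; apply: differentiable_continuous.
  rewrite (_ : f2 i j = n%:R *: psi n.+2 * c i * c j - psi n * cst (i ==
    j)%:R)//.
  have dc k : differentiable (c k) x by exact: differentiable_coordB.
  apply: differentiableB; last first.
    by apply: differentiableM; [exact: dpsi|exact: differentiable_cst].
  do 2 apply: differentiableM => //; apply: differentiableZ; exact: dpsi.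
- move=> x Gx; rewrite /f2 sumrB.
  under eq_bigr do rewrite -mulrA -expr2.
  rewrite -mulr_sumr -euclid_norm_sqr.
  under [X in _ - X]eq_bigr do rewrite eqxx mulr1.
  rewrite sumr_const card_ord /psi; have := Gpos _ Gx;
    set r := euclid_norm _ => r0.
  rewrite -mulr_natl !exprS; apply/eqP; rewrite subr_eq0; apply/eqP.
  by field; rewrite ?gt_eqF ?exprn_gt0.
Qed.

End NewtonKernel.

(** * Monotonicity of the integral *)

Section LowerIntegral.
Local Open Scope ereal_scope.

(* The integral of a nonnegative function is a supremum over simple minorants,
   so monotonicity needs no measurability;
     this matters because h is arbitrary. *)
Lemma ge0_le_integral_nomeas d (T : measurableType d) (R : realType)
    (mu : {measure set T -> \bar R}) (D : set T) (f1 f2 : T -> \bar R) :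
  (forall x, D x -> 0 <= f1 x) -> (forall x, D x -> f1 x <= f2 x) ->
  \int[mu]_(x in D) f1 x <= \int[mu]_(x in D) f2 x.
Proof.
move=> f10 f12.
have f20 x : D x -> 0 <= f2 x by move=> Dx;
  exact: le_trans (f10 _ Dx) (f12 _ Dx).
rewrite !ge0_integralE//; apply: le_ereal_sup => _ [g /= gf1 <-].
by exists g => // x; apply: (le_trans (gf1 x)); exact: lee_restrict.
Qed.

End LowerIntegral.

(** * From the integral hypothesis to a dyadic sum *)

Section DyadicSums.
Context {R : realType}.
Implicit Types (f h m : R -> R) (rho c eps : R).

Lemma dyadic_gt0 rho k : 0 < rho -> 0 < rho / 2 ^+ k.
Proof. by move=> rho0; rewrite divr_gt0// exprn_gt0. Qed.

Lemma dyadic_le rho k l : 0 < rho -> (k <= l)%N -> rho / 2 ^+ l <= rho / 2 ^+ k.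
Proof.
move=> rho0 kl; rewrite ler_wpM2l ?(ltW rho0)// lef_pV2 ?posrE ?exprn_gt0//.
by rewrite ler_weXn2l// ler1n.
Qed.

Lemma dyadic_le0 rho k : 0 < rho -> rho / 2 ^+ k <= rho.
Proof. by move=> rho0; rewrite -[leRHS]divr1 -[1](expr0 2) dyadic_le. Qed.

Lemma dyadic_integral_ge f (a : nat -> R) rho c J : 0 < rho -> rho <= c ->
  (forall r, 0 < r -> 0 <= f r) -> (forall k, 0 <= a k) ->
  (forall k r, rho / 2 ^+ k.+1 < r < rho / 2 ^+ k -> a k <= f r) ->
  ((\sum_(k < J) a k * (rho / 2 ^+ k.+1))%:E <=
    \int[lebesgue_measure]_(r in `]0%R, c[%classic) (f r)%:E)%E.
Proof.
move=> rho0 rhoc f0 a0 af.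
pose I (k : nat) : set R := `]rho / 2 ^+ k.+1, rho / 2 ^+ k[%classic.
have II k l x : I k x -> I l x -> k = l.
  wlog kl : k l / (k <= l)%N.
    move=> H Ik Il; have [kl|/ltnW lk] := leqP k l; first exact: H.
    by apply/esym; exact: H.
  rewrite /I/= !in_itv/= => /andP[kx _] /andP[_ xl].
  apply/eqP; rewrite eqn_leq kl leqNgt; apply/negP => lk.
  by have := lt_trans kx xl; rewrite ltNge dyadic_le.
have mI k : measurable (I k) by exact: measurable_itv.
pose g x : \bar R := (\sum_(k < J) (a k)%:E * (\1_(I k) x)%:E)%E.
have gf x : `]0%R, c[%classic x -> (g x <= (f x)%:E)%E.
  rewrite /= in_itv/= => /andP[x0 _]; rewrite /g.
  have [[k Ikx]|nI] := pselect (exists k : 'I_J, I k x).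
    rewrite (bigD1 k)//= big1 => [|l lk].
      by rewrite indicE mem_set// mule1 adde0 lee_fin; apply: af; move: Ikx;
        rewrite /I/= in_itv.
    rewrite indicE memNset ?mule0// => Ilx.
    by move/eqP: lk; apply; apply: val_inj; exact: II Ilx Ikx.
  rewrite big1 => [|k _]; first by rewrite lee_fin f0.
  by rewrite indicE memNset ?mule0// => Ikx; apply: nI; exists k.
have g0 k x : (0 <= (a k)%:E * (\1_(I k) x)%:E)%E.
  by rewrite mule_ge0// lee_fin.
apply: (@le_trans _ _ (\int[lebesgue_measure]_(r in `]0%R, c[%classic) g
  r)%E); last first.
  apply: ge0_le_integral_nomeas => // x _.
  by apply: sume_ge0 => k _; exact: g0.
rewrite /g ge0_integral_sum//; last first.
  move=> k; apply: measurable_funeM; apply/measurable_EFinP.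
  exact: measurable_indic (mI k).
rewrite -sumEFin lee_sum// => k _.
rewrite ge0_integralZl_EFin//; last first.
  by apply/measurable_EFinP; exact: measurable_indic (mI k).
have Ikc : I k `<=` `]0%R, c[%classic.
  move=> x; rewrite /I/= !in_itv/= => /andP[kx xk].
  rewrite (lt_trans _ kx) ?dyadic_gt0//=.
  exact/(lt_le_trans xk)/(le_trans _ rhoc)/dyadic_le0.
rewrite integral_indic//; last exact: mI.
rewrite (classical_sets.setIidl Ikc).
have k1k : rho / 2 ^+ k.+1 < rho / 2 ^+ k.
  rewrite ltr_pM2l// ltf_pV2 ?posrE ?exprn_gt0//.
  by rewrite ltr_eXn2l// ltr1n.
set muI := (X in (_ <= _ * X)%E);
  have -> : muI = (rho / 2 ^+ k - rho / 2 ^+ k.+1)%:E.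
  by have := lebesgue_measure_itv `]rho / 2 ^+ k.+1, rho / 2 ^+ k[;
    rewrite /= lte_fin k1k.
rewrite -EFinM lee_fin.
rewrite ler_wpM2l// exprS le_eqVlt; apply/orP; left; apply/eqP.
by field; rewrite gt_eqF// exprn_gt0.
Qed.

(** Here [m] stands for the mass of a ball as a function of its radius. Being squeezed between
    multiples of a nondecreasing function, [h] is almost monotone: [A / B * h t <= h r] for
    [t <= r]. This allows a comparison of sum and integral. *)
Lemma dyadic_sum_le (n : nat) h m (A B M c eps0 eps : R) J : (2 <= n)%N ->
  0 < A -> 0 < B -> 4 < c -> 0 < eps -> 4 * eps < eps0 ->
  (forall r, 0 < r -> 0 < h r) ->
  (forall r, 0 < r < eps0 -> A * h r <= m r <= B * h r) ->
  (forall r s, 0 < r -> r <= s -> s < eps0 -> m r <= m s) ->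
  (\int[lebesgue_measure]_(r in `]0%R, (c * eps)%R[%classic)
     (h r / r ^+ n.-1)%:E <= (M * h eps / eps ^+ (n - 2))%:E)%E ->
  \sum_(k < J) h (2 * eps / 2 ^+ k) / (2 * eps / 2 ^+ k) ^+ (n - 2) <=
    B / A * 2 ^+ n.-1 * M * (h eps / eps ^+ (n - 2)).
Proof.
move=> n2 A0 B0 c4 eps_gt0 eps_lt h0 mAB m_nd Hint.
pose t k := 2 * eps / 2 ^+ k.
have t0 k : 0 < t k by rewrite dyadic_gt0 ?mulr_gt0.
(* A lower bound of the integrand on the interval from [t k] to [2 * t k], by almost monotonicity of
   [h] and [r <= 2 * t k]. *)
pose a k := A / B * (h (t k) / (2 * t k) ^+ n.-1).
have rho_gt0 : 0 < 4 * eps by rewrite mulr_gt0.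
(* The hypothesis [4 < c] enters here: the intervals start at [4 * eps] and must fit in the domain
   of integration. *)
have rhoc : 4 * eps <= c * eps by rewrite ler_pM2r// ltW.
have tE k : 4 * eps / 2 ^+ k.+1 = t k.
  by rewrite /t exprS; field; rewrite gt_eqF// exprn_gt0.
have t2E k : 4 * eps / 2 ^+ k = 2 * t k by rewrite /t; field;
  rewrite gt_eqF// exprn_gt0.
have f0 r : 0 < r -> 0 <= h r / r ^+ n.-1.
  by move=> r0; rewrite divr_ge0 ?exprn_ge0 ?ltW// h0.
have a0 k : 0 <= a k.
  by rewrite mulr_ge0// divr_ge0 ?exprn_ge0 ?mulr_ge0 ?ltW ?h0.
have af k r : 4 * eps / 2 ^+ k.+1 < r < 4 * eps / 2 ^+ k ->
  a k <= h r / r ^+ n.-1.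
  rewrite tE t2E => /andP[tr rt]; have r0 := lt_trans (t0 k) tr.
  have r_eps0 : r < eps0.
    by apply: lt_trans eps_lt; apply: (lt_le_trans rt); rewrite -t2E dyadic_le0.
  have /andP[h1 _] := mAB (t k) ltac:(by rewrite t0 (lt_trans tr)).
  have /andP[_ h2] := mAB r ltac:(by rewrite r0).
  have h3 := m_nd _ _ (t0 k) (ltW tr) r_eps0.
  have htr : A / B * h (t k) <= h r.
    rewrite mulrAC ler_pdivrMr// [leRHS]mulrC.
    exact: le_trans h1 (le_trans h3 h2).
  rewrite /a mulrA ler_pM//.
  - by rewrite mulr_ge0 ?divr_ge0 ?ltW ?h0.
  - by rewrite invr_ge0 exprn_ge0// mulr_ge0 ?ltW.
  - rewrite lef_pV2 ?posrE ?exprn_gt0 ?mulr_gt0//.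
    by rewrite lerXn2r ?nnegrE ?mulr_ge0 ?ltW.
have := le_trans (dyadic_integral_ge J rho_gt0 rhoc f0 a0 af) Hint.
rewrite lee_fin => H.
have aE k : h (t k) / t k ^+ (n - 2) = B / A * 2 ^+ n.-1 * (a k * t k).
  have := t0 k; rewrite /a; move: (t k) => x x0.
  case: (n) n2 => [//|[//|p _]]; rewrite !subSS subn0 /= exprMn !exprS.
  have xp0 : x ^+ p != 0 by rewrite gt_eqF// exprn_gt0.
  by field; rewrite ?xp0 ?expf_neq0 ?gt_eqF.
under eq_bigr do rewrite -/(t _) aE.
rewrite -mulr_sumr -[leRHS]mulrA ler_wpM2l//.
  by rewrite mulr_ge0 ?exprn_ge0// divr_ge0// ltW.
rewrite mulrA; apply: le_trans H; apply: ler_sum => k _.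
by rewrite tE.
Qed.

End DyadicSums.

(** * Discrete layer-cake estimate *)

Section LayerCake.
Context {R : realType}.

(** The increments of [g] over the layers with [s < r k] telescope up to its value at the first
    radius that is at most [s]. *)
Lemma layer_cake_le (g : R -> R) (r : nat -> R) (J : nat) (s : R) :
  (forall a b, 0 < a -> a <= b -> g b <= g a) ->
  (forall k, 0 < r k) -> (forall k, r k.+1 <= r k) -> r J <= s ->
  g s <= g (r 0%N) + \sum_(k < J | s < r k) (g (r k.+1) - g (r k)).
Proof.
move=> g_dec r0 r_dec; elim: J => [|J IH] rs.
  by rewrite big_ord0 addr0 g_dec.
rewrite big_mkcond big_ord_recr/= -big_mkcond/=.
have [rJs|sJ] := leP (r J) s; first by rewrite addr0 IH.
(* Now [s] lies below all [r k] with [k <= J]: every increment is present and the whole sum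
   telescopes. *)
have r_anti : {homo r : k l / (k <= l)%N >-> l <= k}.
  apply: homo_leq => // x y z yx zy; exact: le_trans zy yx.
rewrite (eq_bigl xpredT) => [|k]; last first.
  by apply: lt_le_trans sJ _; apply: r_anti; exact: ltnW.
rewrite -(big_mkord xpredT (fun k => g (r k.+1) - g (r k))) telescope_sumr//.
rewrite (_ : _ + _ = g (r J.+1)); last by ring.
by apply: g_dec => //; exact: ltW.
Qed.

(** Exchanging the sums over masses and layers bounds a potential by the masses of concentric balls
    only. *)
Lemma discrete_layer_cake_le (g : R -> R) (r : nat -> R) (J N : nat)
    (s w : 'I_N -> R) (b : R) :
  (forall a b, 0 < a -> a <= b -> g b <= g a) ->
  (forall k, 0 < r k) -> (forall k, r k.+1 <= r k) ->
  (forall i, r J <= s i) -> (forall i, 0 <= w i) ->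
  \sum_(i < N) w i * (g (s i) - b) <=
    (g (r 0%N) - b) * \sum_(i < N) w i +
    \sum_(k < J) (g (r k.+1) - g (r k)) * \sum_(i < N | s i < r k) w i.
Proof.
move=> g_dec r0 r_dec rs w0.
apply: (@le_trans _ _ (\sum_(i < N) (w i * (g (r 0%N) - b) +
   \sum_(k < J) (if s i < r k then w i * (g (r k.+1) - g (r k)) else 0)))).
  apply: ler_sum => i _; rewrite -big_mkcond/= -mulr_sumr -mulrDr.
  rewrite ler_wpM2l// addrAC lerD2r.
  exact: layer_cake_le.
rewrite big_split/= -mulr_suml mulrC lerD2l exchange_big/=.
apply: ler_sum => k _; rewrite -big_mkcond/= -mulr_suml mulrC.
by rewrite lexx.
Qed.

End LayerCake.

(** * Borel sets: fine partitions and inner approximation *)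

Section BorelMeasure.
Context {R : realType} {n : nat}.
Local Notation V := 'rV[R]_n.
Implicit Types (E L U N : set V) (x y z : V).

Lemma open_borel_set U : open U -> borel_set U.
Proof. by move=> oU; exact: sub_sigma_algebra. Qed.

Lemma borel_set_bigsetU (J : nat) (F : 'I_J -> set V) (P : pred 'I_J) :
  (forall i, borel_set (F i)) -> borel_set (\big[setU/set0]_(i < J | P i) F i).
Proof.
by move=> mF; apply: (@bigsetU_measurable _ (borelV R n)) => i _; exact: mF.
Qed.

(** Compactness of the closed ball yields a finite cover by balls of radius [tau / 2]; successive
    differences make their traces on [L] disjoint. *)
Lemma borel_partition L x0 (rho tau : R) : borel_set L -> L !=set0 ->
  L `<=` eball x0 rho -> 0 < tau ->
  exists (J : nat) (P : 'I_J -> set V) (y : 'I_J -> V),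
    [/\ forall i, borel_set (P i), trivIset setT P,
        L = \big[setU/set0]_(i < J) P i, forall i, L (y i) &
        forall i z, P i z -> euclid_norm (z - y i) < tau].
Proof.
move=> mL [z0 Lz0] Lrho tau0.
have := @closed_eball_compact R n x0 rho; rewrite compact_cover.
move=> /(_ V setT (fun z => eball z (tau / 2))) [].
- by move=> z _; exact: eball_open.
- by move=> z _; exists z => //; apply: eball_center; rewrite divr_gt0.
move=> D _ Dcov; set s := finmap.enum_fset D.
pose Q k := L `&` eball (nth 0 s k) (tau / 2).
have mQ k : borel_set (Q k).
  apply: (@measurableI _ (borelV R n)) => //.
  by apply: open_borel_set; exact: eball_open.
pose P k := seqDU Q k.
have PQ k z : P k z -> Q k z by move=> [].
(* An empty piece receives the default pole [z0], so that every pole belongs to [L]. *)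
pose y k := if pselect (exists z, P k z) is left e then sval (cid e) else z0.
exists (size s), (fun i => P i), (fun i => y i); split.
- move=> i; apply: (@measurableD _ (borelV R n)); first exact: mQ.
  exact: borel_set_bigsetU.
- move=> i j _ _ Pij; apply: val_inj.
  exact: (@trivIset_seqDU _ Q i j).
- rewrite -(bigsetU_seqDU Q) -bigcup_mkord; apply/seteqP;
    split=> [z Lz|z [k _ []//]].
  have [w Dw wz] := Dcov z (ltW (Lrho _ Lz)).
  exists (index w s) => /=; first by rewrite index_mem.
  by split=> //; rewrite nth_index.
- move=> i; rewrite /y; case: pselect => // e; case: cid => z /= /PQ[] //.
- move=> i z Pz; rewrite /y; case: pselect => [e|[]]; last by exists z.
  case: cid => w /= /PQ[_ wi]; have [_ zi] := PQ _ _ Pz.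
  apply: (le_lt_trans (euclid_dist_triangle (nth 0 s i) _ _)).
  by rewrite [ltRHS]splitr ltrD// euclid_distC.
Qed.

Variable mu : {measure set (borelV R n) -> \bar R}.

(** The parts of [E] at depth [1 / (j + 1)] in [U] increase to the intersection of [E] with [U],
    which has the mass of [E] since [N] is null; continuity from below gives one whose mass exceeds
    [a]. *)
Lemma borel_deep_part E U N (a : R) : borel_set E -> open U -> borel_set N ->
  mu N = 0%E -> E `\` N `<=` U -> (a%:E < mu E)%E ->
  exists L (delta : R), [/\ 0 < delta, borel_set L, L `<=` E,
    forall x, L x -> eball x delta `<=` U & (a%:E < mu L)%E].
Proof.
move=> mE oU mN N0 ENU aE.
pose F (j : nat) := [set x | eball x j.+1%:R^-1 `<=` U].
have mF j : borel_set (F j).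
  (* [F j] is closed: its complement is the union of the open balls centred outside [U]. *)
  rewrite -[F j]setCK; apply: (@measurableC _ (borelV R n));
    apply: open_borel_set.
  rewrite (_ : ~` F j = \bigcup_(z in ~` U) eball z j.+1%:R^-1).
    by apply: bigcup_open => z _; exact: eball_open.
  apply/seteqP; split=> [x /=|x [z /= nUz xz] xU].
    move=> /existsNP[z /not_implyP[xz nUz]]; exists z => //.
    by rewrite /eball/= euclid_distC.
  by apply: nUz; apply: xU; rewrite /eball/= euclid_distC.
pose L j := E `&` F j.
have mL j : borel_set (L j) by exact: (@measurableI _ (borelV R n) _ _ mE (mF
  j)).
have LU : \bigcup_j L j = E `&` U.
  apply/seteqP; split=> [x [j _ [Ex Fx]]|x [Ex Ux]].
    by split=> //; apply: Fx; apply: eball_center; rewrite invr_gt0.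
  have [r r0 rU] := nbhs_eball (open_nbhs_nbhs (conj oU Ux)).
  exists (Num.truncn r^-1) => //; split=> //; apply: subset_trans rU.
  apply: subset_eball; rewrite invf_ple ?posrE//.
  exact/ltW/truncnS_gt.
have muEU : (mu E <= mu (E `&` U))%E.
  rewrite -[leRHS]adde0 -N0; apply: le_trans (measureU2 mu _ _) => //.
    apply: le_measure; rewrite ?inE//.
    - apply: measurableU => //; apply: (@measurableI _ (borelV R n)) => //.
      exact: open_borel_set.
    - move=> x Ex; have [Nx|nNx] := pselect (N x); first by right.
      by left; split=> //; apply: ENU.
  apply: (@measurableI _ (borelV R n)) => //; exact: open_borel_set.
apply: contrapT => noL.
have Lle j : (mu (L j) <= a%:E)%E.
  rewrite leNgt; apply/negP => aL; apply: noL.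
  by exists (L j), j.+1%:R^-1; split=> [||x []|x []|] //; exact: mL.
have cvgL : mu (L j) @[j --> \oo] --> mu (\bigcup_j L j).
  apply: nondecreasing_cvg_mu => //.
    by apply: (@bigcup_measurable _ (borelV R n)) => j _; exact: mL.
  move=> i j ij; apply/subsetPset => x [Ex Fx]; split=> //.
  apply: subset_trans Fx; apply: subset_eball.
  by rewrite lef_pV2 ?posrE// ler_nat.
have : (mu (\bigcup_j L j) <= a%:E)%E.
  rewrite -(cvg_lim _ cvgL)//; apply: lime_le; first by apply/cvg_ex;
    eexists; exact: cvgL.
  by apply: nearW => j; exact: Lle.
rewrite LU => /(le_trans muEU) /(lt_le_trans aE).
by rewrite ltxx.
Qed.

Lemma sum_fine_measure (J : nat) (F : 'I_J -> set V) (P : pred 'I_J) :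
  (forall i, borel_set (F i)) -> trivIset setT F ->
  (mu (\big[setU/set0]_(i < J) F i) < +oo)%E ->
  (\sum_(i < J | P i) fine (mu (F i)))%:E =
    mu (\big[setU/set0]_(i < J | P i) F i).
Proof.
move=> mF tF fin.
have tF' : trivIset [set` P] F by exact: sub_trivIset tF.
rewrite (measure_bigsetU_ord_cond mu (P:=P) (fun i _ => mF i) tF') -sumEFin.
apply: eq_bigr => i _; rewrite fineK// ge0_fin_numE//.
apply: le_lt_trans fin; apply: le_measure; rewrite ?inE//.
- exact: mF.
- exact: borel_set_bigsetU.
- by move=> z Fz; rewrite (bigD1 i)//=; left.
Qed.

End BorelMeasure.

(** * Point masses and two-sided bounds on their potential *)

Section Barrier.
Context {R : realType} {n : nat}.
Local Notation V := 'rV[R]_n.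
Variables (K : set V) (h : R -> R) (A B eps0 : R).
Variable mu : {measure set (borelV R n) -> \bar R}.
Hypothesis n2 : (2 <= n)%N.
Hypothesis mK : borel_set K.
Hypothesis h_gt0 : forall r, 0 < r -> 0 < h r.
Hypothesis A_gt0 : 0 < A.
Hypothesis B_gt0 : 0 < B.
Hypothesis muK : forall x, K x -> forall r, 0 < r < eps0 ->
  ((A * h r)%:E <= mu (K `&` eball x r) <= (B * h r)%:E)%E.

Let mKball x r : borel_set (K `&` eball x r).
Proof.
apply: (@measurableI _ (borelV R n)) => //.
by apply: open_borel_set; exact: eball_open.
Qed.

Let muK_fin x r : K x -> 0 < r < eps0 -> mu (K `&` eball x r) \is a fin_num.
Proof.
move=> Kx r0; rewrite ge0_fin_numE//; have /andP[_] := muK Kx r0.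
by move=> /le_lt_trans; apply; rewrite ltry.
Qed.

(* Replaces mu restricted to L by point masses sitting in L, at a scale tau
   fine enough to be invisible from points at distance at least tau. *)
Lemma discrete_mass x0 (L : set V) (a eps tau : R) : K x0 -> borel_set L ->
  L `<=` K `&` eball x0 eps -> 0 < eps < eps0 -> 0 <= a ->
    (a%:E < mu L)%E -> 0 < tau ->
  exists (J : nat) (y : 'I_J -> V) (w : 'I_J -> R),
    [/\ forall i, L (y i), forall i, 0 <= w i,
        a <= \sum_(i < J) w i, \sum_(i < J) w i <= B * h eps &
        forall x i0 r, (forall i, tau <= euclid_norm (x - y i)) ->
          euclid_norm (x - y i0) <= tau -> 0 < 4 * r < eps0 ->
          \sum_(i < J | euclid_norm (x - y i) < r) w i <= B * h (4 * r)].
Proof.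
move=> Kx0 mL LK eps_bd a0 aL tau0.
have L0 : L !=set0.
  apply/set0P/negP => /eqP L0; move: aL; rewrite L0 measure0 lte_fin.
  by rewrite ltNge a0.
have Lfin : (mu L <= (B * h eps)%:E)%E.
  have /andP[_] := muK Kx0 eps_bd; apply: le_trans.
  by apply: le_measure; rewrite ?inE; [exact: mL|exact: mKball|exact: LK].
have Lball : L `<=` eball x0 eps by move=> z /LK[].
have [J [P [y [mP tP LP Ly Py]]]] := borel_partition mL L0 Lball tau0.
have fin : (mu (\big[setU/set0]_(i < J) P i) < +oo)%E.
  by rewrite -LP (le_lt_trans Lfin)// ltry.
have sumw := sum_fine_measure (mu:=mu) _ mP tP fin.
have sumT : (\sum_(i < J) fine (mu (P i)))%:E = mu L by rewrite sumw -LP.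
exists J, y, (fun i => fine (mu (P i))); split=> //.
- by rewrite -lee_fin sumT ltW.
- by rewrite -lee_fin sumT.
(* As [x] may lie outside [K], the ball is recentred at [y i0]. A pole counted in the sum gives
   [tau < r], so its piece is within [tau + r + tau < 4 * r] of [y i0]. *)
move=> x i0 r xy xi0 r_bd; rewrite -lee_fin sumw.
have Kyi0 : K (y i0) by have [] := LK _ (Ly i0).
have /andP[_] := muK Kyi0 r_bd; apply: le_trans.
apply: le_measure; rewrite ?inE; [exact: borel_set_bigsetU|exact: mKball|].
move=> z zP.
have [i xir Pz] : exists2 i, euclid_norm (x - y i) < r & P i z.
  by move: zP; elim/big_rec : _ => // i S xir IH [Piz|/IH//]; exists i.
split.
  by have [] := LK z _; rewrite // LP (bigD1 i)//=; left.
rewrite /eball/=.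
have zy := Py i z Pz.
have tr1 := euclid_dist_triangle (y i) z (y i0).
have tr2 := euclid_dist_triangle x (y i) (y i0).
have taur := le_lt_trans (xy i) xir.
move: tr2; rewrite (euclid_distC (y i) x) => tr2.
lra.
Qed.

(** The nondecreasing function comparable with [h] is the mass of [K] in balls around [x0]. *)
Lemma dyadic_sum_h_le x0 (M c eps : R) J : K x0 -> 4 < c -> 0 < eps ->
  4 * eps < eps0 ->
  (\int[lebesgue_measure]_(r in `]0%R, (c * eps)%R[%classic)
     (h r / r ^+ n.-1)%:E <= (M * h eps / eps ^+ (n - 2))%:E)%E ->
  \sum_(k < J) h (2 * eps / 2 ^+ k) / (2 * eps / 2 ^+ k) ^+ (n - 2) <=
    B / A * 2 ^+ n.-1 * M * (h eps / eps ^+ (n - 2)).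
Proof.
move=> Kx0 c4 eps_gt0 eps_lt; apply: (dyadic_sum_le _ (eps0 := eps0)
  (m := fun r => fine (mu (K `&` eball x0 r)))) => // [r r_bd|r s r0 rs s_lt].
  by rewrite -!lee_fin fineK ?muK_fin// muK.
have s_bd : 0 < s < eps0 by rewrite (lt_le_trans r0 rs).
have r_bd : 0 < r < eps0 by rewrite r0 (le_lt_trans rs).
apply: fine_le; [exact: muK_fin|exact: muK_fin|].
apply: le_measure; rewrite ?inE; [exact: mKball|exact: mKball|].
by move=> z [Kz zr]; split=> //; exact: subset_eball zr.
Qed.

(** At [x0] all the mass is within [eps], so each kernel is at least its value at [eps]. Next to a
    pole, the layer-cake estimate combines the recentred mass bounds with the dyadic sum. *)
Lemma newton_potential x0 (L : set V) (M c eps tau : R) : K x0 -> ~ L x0 ->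
  borel_set L -> L `<=` K `&` eball x0 eps -> 4 < c -> 0 < eps ->
    4 * eps < eps0 ->
  ((A * h eps / 2)%:E < mu L)%E -> 0 < tau ->
  (\int[lebesgue_measure]_(r in `]0%R, (c * eps)%R[%classic)
     (h r / r ^+ n.-1)%:E <= (M * h eps / eps ^+ (n - 2))%:E)%E ->
  exists (J : nat) (y : 'I_J -> V) (w : 'I_J -> R),
    let p x := \sum_(i < J) w i *
                 (newton n (euclid_norm (x - y i)) - newton n (3 * eps)) in
    [/\ forall i, L (y i), forall i, 0 <= w i,
        A / 3 ^+ n.-1 * (h eps / eps ^+ (n - 2)) <= p x0 &
        forall x i0, (forall i, tau <= euclid_norm (x - y i)) ->
          euclid_norm (x - y i0) <= tau ->
          p x <= (5 / 2 * 2 ^+ n.-1 * B +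
            B * 8 ^+ (n - 2) * (B / A * 2 ^+ n.-1 * M)) *
            (h eps / eps ^+ (n - 2))].
Proof.
move=> Kx0 nLx0 mL LK c4 eps_gt0 eps_lt aL tau0 Hint.
have heps := h_gt0 eps_gt0.
have [p nE] : exists p, n = p.+2 by exists (n - 2)%N;
  case: (n) n2 => [|[|m]]// _; rewrite subn2.
have eps_bd : 0 < eps < eps0 by rewrite eps_gt0; lra.
have a0 : 0 <= A * h eps / 2 by rewrite divr_ge0// mulr_ge0// ltW.
have [J [y [w [Ly w0 wa wB wr]]]] := discrete_mass Kx0 mL LK eps_bd a0 aL tau0.
have Nle (a b : R) : 0 < a -> a <= b ->
  newton n b <= newton n a by exact: newton_le.
exists J, y, w; split=> // [|x i0 xy xi0].
- have eps3 : eps <= 3 * eps by lra.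
  have /andP[lo _] := newtonB_bounds n2 eps_gt0 eps3.
  (* Total mass at least [A * h eps / 2], times the lower bound [2 * eps / (3 * eps) ^+ n.-1] for
     the kernel. *)
  apply: (@le_trans _ _ ((\sum_(i < J) w i) * ((3 * eps - eps) * ((3 * eps) ^+
    n.-1)^-1))).
    apply: (@le_trans _ _ (A * h eps / 2 * ((3 * eps - eps) * ((3 * eps) ^+
      n.-1)^-1))).
      rewrite le_eqVlt; apply/orP; left; apply/eqP.
      rewrite nE !subSS subn0 /= exprMn !exprS.
      by field; rewrite ?expf_neq0 ?gt_eqF.
    apply: ler_wpM2r => //; apply: mulr_ge0; first by lra.
    by rewrite invr_ge0; apply: exprn_ge0; lra.
  rewrite mulr_suml; apply: ler_sum => i _; rewrite ler_wpM2l//.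
  apply: (le_trans lo); rewrite lerD2r; apply: Nle.
    apply: euclid_norm_gt0; rewrite subr_eq0; apply/eqP => x0y.
    by apply: nLx0; rewrite x0y.
  by rewrite euclid_distC ltW//; have [_] := LK _ (Ly i).
(* The layers start at [eps / 2] so that the recentred radii [4 * r k] are the radii [t k] of the
   dyadic sum. *)
pose r k := eps / 2 / 2 ^+ k; pose t k := 2 * eps / 2 ^+ k.
have eps2 : 0 < eps / 2 by rewrite divr_gt0.
have r0 k : 0 < r k by exact: dyadic_gt0.
have t0 k : 0 < t k by rewrite dyadic_gt0 ?mulr_gt0.
have rS k : r k.+1 <= r k by exact: dyadic_le.
have tr k : t k = 4 * r k by rewrite /t /r; field; rewrite expf_neq0.
have tr8 k : t k = 8 * r k.+1 by rewrite /t /r exprS; field; rewrite expf_neq0.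
(* All poles are at distance at least [tau] from [x], so finitely many layers suffice. *)
have [m rm] : exists m, r m <= tau.
  exists (Num.truncn (eps / 2 / tau)).+1; rewrite /r ler_pdivrMr ?exprn_gt0//.
  rewrite [leRHS]mulrC -ler_pdivrMr//; apply/ltW/(lt_trans (truncnS_gt _)).
  by rewrite -natrX ltr_nat ltn_expl.
apply: (le_trans (discrete_layer_cake_le (newton n (3 * eps)) Nle r0 rS
  (fun i => le_trans rm (xy i)) w0)).
rewrite [leRHS]mulrDl; apply: lerD.
- have r03 : r 0%N <= 3 * eps by rewrite /r expr0; lra.
  have /andP[_ hi] := newtonB_bounds n2 (r0 0%N) r03.
  apply: (@le_trans _ _ ((3 * eps - r 0%N) * (r 0%N ^+ n.-1)^-1 * (B * h eps))).
    rewrite ler_pM// ?sumr_ge0//.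
    by rewrite subr_ge0 Nle.
  rewrite le_eqVlt; apply/orP; left; apply/eqP.
  rewrite /r expr0 divr1 nE !subSS subn0 /= exprMn exprVn !exprS.
  by field; rewrite ?expf_neq0 ?gt_eqF.
(* Layer [k] has mass at most [B * h (t k)] and kernel increment at most [r k.+1] to the power
   [2 - n]; the factor [8 ^+ (n - 2)] comes from [t k = 8 * r k.+1]. *)
apply: (@le_trans _ _ (\sum_(k < m) B * 8 ^+ (n - 2) * (h (t k) / t k ^+ (n -
  2)))); last first.
  rewrite -mulr_sumr -[leRHS]mulrA ler_wpM2l//.
    by rewrite mulr_ge0 ?exprn_ge0// ltW.
  exact: (dyadic_sum_h_le m Kx0 c4 eps_gt0 eps_lt Hint).
apply: ler_sum => k _.
have /andP[_ hi] := newtonB_bounds n2 (r0 k.+1) (rS k).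
apply: (@le_trans _ _ ((r k - r k.+1) * (r k.+1 ^+ n.-1)^-1 * (B * h (t k)))).
  rewrite ler_pM// ?sumr_ge0//.
    by rewrite subr_ge0 Nle.
  rewrite tr; apply: (wr x i0) => //; rewrite -tr t0/=.
  apply: le_lt_trans eps_lt; apply: (le_trans (dyadic_le0 _ _)); lra.
have rE : r k = 2 * r k.+1 by rewrite /r exprS; field; rewrite expf_neq0.
rewrite le_eqVlt; apply/orP; left; apply/eqP.
rewrite tr8 rE; have := r0 k.+1; move: (r k.+1) (h _) => s hs s0.
rewrite nE !subSS subn0 /= exprMn !exprS.
by field; rewrite ?expf_neq0 ?gt_eqF.
Qed.

End Barrier.

(** * Maximum principle on a ball without small balls around the poles *)

Section PuncturedBall.
Context {R : realType} {n : nat}.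
Local Notation V := 'rV[R]_n.

Lemma open_dist_gt J (y : 'I_J -> V) (r : R) :
  open [set x | forall i, r < euclid_norm (x - y i)].
Proof.
rewrite openE => x /= xr; rewrite /interior.
have near_gt i : \forall z \near x, r < euclid_norm (z - y i).
  have oi : open [set z : V | r < euclid_norm (z - y i)].
    rewrite (_ : mkset _ = (fun z =>
      euclid_norm (z - y i)) @^-1` [set t | r < t])//.
    by apply: open_comp => [z _|];
      [exact: euclid_dist_continuous|exact: open_gt].
  by apply: open_nbhs_nbhs; split=> //; exact: xr.
exact: filter_forall near_gt.
Qed.

Lemma harmonic_on_newton_potential J (y : 'I_J -> V) (w : 'I_J -> R) (b s l : R)
    (G : set V) : (2 <= n)%N -> open G -> (forall i, ~ G (y i)) ->
  harmonic_on G (fun x =>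
    b - l * \sum_(i < J) w i * (newton n (euclid_norm (x - y i)) - s)).
Proof.
move=> n2 oG nGy.
rewrite (_ : (fun x => _) = cst b + (- l) *: \sum_(i < J)
   w i *: ((fun x => newton n (euclid_norm (x - y i))) + cst (- s)));
     last first.
  apply/funext => x; rewrite !fctE fct_sumE /GRing.scale/= mulNr.
  by congr (_ - _ * _).
apply: harmonic_onD => //; first exact: harmonic_on_cst.
apply: harmonic_onZ => //; apply: harmonic_on_sum => // i.
apply: harmonic_onZ => //; apply: harmonic_onD => //;
  last exact: harmonic_on_cst.
exact: harmonic_on_newton.
Qed.

Lemma harmonic_on_subset (G H : set V) (f : V -> R) : G `<=` H ->
  harmonic_on H f -> harmonic_on G f.
Proof.
move=> GH [[df [ddf cf]] lf]; split; last by move=> x /GH; exact: lf.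
by split; [move=> x /GH; exact: df|split=> [i x /GH|i j x /GH];
  [exact: ddf|exact: cf]].
Qed.

Lemma harmonic_on_continuous (G : set V) (f : V -> R) x :
  harmonic_on G f -> G x -> {for x, continuous f}.
Proof. by move=> [[df _] _] Gx; exact/differentiable_continuous/df. Qed.

(** Subharmonicity is applied on the punctured ball: a boundary point is on the outer sphere or
    within [tau] of some pole, and none is closer than [tau] to any pole. *)
Lemma subharmonic_le_newton_potential (O : set V) (v : V -> \bar R) (x0 : V)
    (rho tau b s l : R) J (y : 'I_J -> V) (w : 'I_J -> R) :
  let phi x :=
    b - l * \sum_(i < J) w i * (newton n (euclid_norm (x - y i)) - s) in
  (2 <= n)%N -> subharmonic_on O v -> 0 < rho -> 0 < tau ->
  [set x | euclid_norm (x - x0) <= rho] `<=` O ->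
  (forall i, tau < euclid_norm (x0 - y i)) ->
  (forall x, euclid_norm (x - x0) = rho -> (v x <= (phi x)%:E)%E) ->
  (forall x i, euclid_norm (x - x0) <= rho -> euclid_norm (x - y i) <= tau ->
     (forall j, tau <= euclid_norm (x - y j)) -> (v x <= (phi x)%:E)%E) ->
  (v x0 <= (phi x0)%:E)%E.
Proof.
move=> phi n2 [_ _ _ maxv] rho0 tau0 ballO x0y v_sphere v_poles.
pose G := eball x0 rho `&` [set x | forall i, tau < euclid_norm (x - y i)].
have oG : open G by apply: openI; [exact: eball_open|exact: open_dist_gt].
have cl_sub B x : closed B -> G `<=` B -> closure G x -> B x.
  by move=> cB GB /(closureS GB); exact: cB.
have clG x : closure G x ->
    euclid_norm (x - x0) <= rho /\ forall i, tau <= euclid_norm (x - y i).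
  move=> clGx; split=> [|i].
    apply: (cl_sub [set z | euclid_norm (z - x0) <= rho]) => //.
      exact: closed_eball_closed.
    by move=> z [/ltW].
  apply: (cl_sub [set z | tau <= euclid_norm (z - y i)]) => //.
    rewrite (_ : mkset _ = (fun z =>
      euclid_norm (z - y i)) @^-1` [set t | tau <= t])//.
    by apply: closed_comp => [z _|];
      [exact: euclid_dist_continuous|exact: closed_ge].
  by move=> z [_ /(_ i)/ltW].
(* [phi] is harmonic off the poles, an open set containing the closure of [G]; this gives continuity
   up to the boundary. *)
pose H := [set x : V | forall i, 0 < euclid_norm (x - y i)].
have harmH : harmonic_on H phi.
  apply: harmonic_on_newton_potential => // [|i]; first exact: open_dist_gt.
  by move=> /(_ i); rewrite subrr euclid_norm0 ltxx.
have GH : closure G `<=` H.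
  by move=> x /clG[_ xy] i; exact: lt_le_trans tau0 (xy i).
apply: (maxv G) => //.
- apply: subclosed_compact (@closed_eball_compact _ _ x0 rho) _.
    exact: closed_closure.
  by move=> x /clG[].
- by move=> x /clG[? _]; exact: ballO.
- apply: harmonic_on_subset harmH; apply: subset_trans GH;
    exact: subset_closure.
- apply: continuous_in_subspaceT => x /set_mem /GH Hx.
  exact: harmonic_on_continuous harmH Hx.
- move=> x [/clG[xrho xy] nGx].
  have [xrho'|rhox] := ltP (euclid_norm (x - x0)) rho; last first.
    by apply: v_sphere; apply/eqP; rewrite eq_le xrho.
  have [i xi] : exists i, euclid_norm (x - y i) <= tau.
    apply: contrapT => nxi; apply: nGx; split=> // i.
    by rewrite ltNge; apply/negP => xi; apply: nxi; exists i.
  exact: v_poles xi xy.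
- by split=> //; exact: eball_center.
Qed.

End PuncturedBall.

(** * Contradiction at a point of [K] where [u < v] *)

Lemma ereal_separate {R : realType} (s t : \bar R) : (s < t)%E -> t != +oo%E ->
  exists a b : R, [/\ (s < a%:E)%E, a < b & t = b%:E].
Proof.
case: t => [b| |]//; last by rewrite ltNge leNye.
move=> + _; case: s => [c| |]//; rewrite ?lte_fin => cb.
  by exists ((c + b) / 2), b; split=> //; rewrite ?lte_fin; lra.
by exists (b - 1), b; split=> //; rewrite ?ltNyr//; lra.
Qed.

Theorem theorem2 (R : realType) (n : nat) (hn : (2 <= n)%N)
  (Omega : set 'rV[R]_n) (u v : 'rV[R]_n -> \bar R) (K : set 'rV[R]_n)
  (h : R -> R) :
  domain Omega -> usc_on Omega u -> subharmonic_on Omega v ->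
  borel_set K -> K `<=` Omega ->
  (forall r : R, 0 < r -> 0 < h r) ->
  (exists M c : R, [/\ 0 < M, 4 < c & exists2 d : R, 0 < d &
     forall eps : R, 0 < eps < d ->
       (\int[lebesgue_measure]_(r in `]0%R, (c * eps)%R[%classic) (h r / r ^+ n.-1)%:E
          <= (M * h eps / eps ^+ (n - 2))%:E)%E]) ->
  forall (mu : {measure set (borelV R n) -> \bar R}) (A B eps0 : R)
         (N : set 'rV[R]_n),
  0 < A -> 0 < B -> 0 < eps0 ->
  N `<=` K -> borel_set N -> mu N = 0%E ->
  (forall x, K x -> forall eps : R, 0 < eps < eps0 ->
     ((A * h eps)%:E <= mu (K `&` eball x eps) <= (B * h eps)%:E)%E) ->
  (forall x, (K `\` N) x -> (v x <= u x)%E) ->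
  forall x, K x -> (v x <= u x)%E.
Proof.
move=> domO uscu subv mK KO h_gt0 [M [c [M_gt0 c4 [d d_gt0 Hint]]]].
move=> mu A B eps0 N A_gt0 B_gt0 eps0_gt0 NK mN N0 muK vu x0 Kx0.
rewrite leNgt; apply/negP => uv.
have [uscv vpoo _ _] := subv.
have Ox0 := KO _ Kx0.
have [a [b [ua ab vb]]] := ereal_separate uv (vpoo _ Ox0).
(* [C] and [c'] are the constants of [newton_potential], next to the poles and at [x0]. They are
   fixed before [eps], so [eta] may depend on them. *)
pose C := 5 / 2 * 2 ^+ n.-1 * B + B * 8 ^+ (n - 2) * (B / A * 2 ^+ n.-1 * M).
pose c' := A / 3 ^+ n.-1.
have C_gt0 : 0 < C.
  by rewrite addr_gt0 ?mulr_gt0 ?exprn_gt0 ?invr_gt0.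
have c'_gt0 : 0 < c' by rewrite divr_gt0// exprn_gt0.
pose eta := (b - a) * c' / (2 * C).
have eta_gt0 : 0 < eta by rewrite divr_gt0 ?mulr_gt0 ?subr_gt0.
have veta : (v x0 < (b + eta)%:E)%E by rewrite vb lte_fin ltrDl.
have [oO _] := domO.
have [r1 r1_gt0 r1P] := nbhs_eball (uscu _ Ox0 _ ua).
have [r2 r2_gt0 r2P] := nbhs_eball (uscv _ Ox0 _ veta).
have [r3 r3_gt0 r3P] := nbhs_eball (open_nbhs_nbhs (conj oO Ox0)).
pose r := Num.min (Num.min r1 r2) (Num.min r3 (Num.min d eps0)).
have r_gt0 : 0 < r by rewrite !lt_min r1_gt0 r2_gt0 r3_gt0 d_gt0.
have [rr1 rr2 rr3 rd reps0] :
  [/\ r <= r1, r <= r2, r <= r3, r <= d & r <= eps0].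
  by split; rewrite /r !ge_min lexx ?orbT.
(* The closed ball of radius [4 * eps] then lies well inside the ball of radius [r], and
   [4 * eps < eps0], [eps < d]. *)
pose eps := r / 8.
have eps_gt0 : 0 < eps by rewrite divr_gt0.
have reps : r = 8 * eps by rewrite /eps; field.
have eps4 : 4 * eps < eps0 by lra.
have eps_d : 0 < eps < d by rewrite eps_gt0/=; lra.
pose H := h eps / eps ^+ (n - 2).
have H_gt0 : 0 < H by rewrite divr_gt0 ?exprn_gt0 ?h_gt0.
pose U := Omega `&` [set x | (v x < a%:E)%E].
have oU : open U.
  rewrite openE => x [Ox vxa]; apply: filterI; last exact: uscv.
  exact: open_nbhs_nbhs.
pose E := K `&` eball x0 eps.
have mE : borel_set E.
  apply: (@measurableI _ (borelV R n)) => //.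
  by apply: open_borel_set; exact: eball_open.
have ENU : E `\` N `<=` U.
  move=> x [[Kx x_eps] nNx]; split; first exact: KO.
  apply: le_lt_trans (vu x (conj Kx nNx)) _.
  by apply: r1P; apply: subset_eball x_eps; lra.
(* Halving the lower mass bound makes it strict, which leaves room for the mass lost in passing from
   [E] to [L]. *)
have muE : ((A * h eps / 2)%:E < mu E)%E.
  have eps_bd : 0 < eps < eps0 by rewrite eps_gt0/=; lra.
  have /andP[+ _] := muK _ Kx0 _ eps_bd; apply: lt_le_trans.
  rewrite lte_fin ltr_pdivrMr// ltr_pMr ?mulr_gt0 ?h_gt0// ltr1n//.
have [L [delta [delta_gt0 mL LE LU muL]]] :=
  borel_deep_part mE oU mN N0 ENU muE.
(* Closed balls of radius [tau] around points of [L] stay in [U], where [v < a]; hence they miss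
   [x0], where [v] equals [b]. *)
pose tau := delta / 2.
have tau_gt0 : 0 < tau by rewrite divr_gt0.
have tau_delta : tau < delta by rewrite /tau; lra.
have near_L y z : L y -> euclid_norm (z - y) <= tau -> (v z < a%:E)%E.
  move=> Ly zy; have [] // := LU y Ly z.
  exact: le_lt_trans zy tau_delta.
have x0_far y : L y -> tau < euclid_norm (x0 - y).
  move=> Ly; rewrite ltNge; apply/negP => /(near_L _ _ Ly).
  by rewrite vb lte_fin ltNge ltW.
have nLx0 : ~ L x0.
  by move=> /x0_far; rewrite subrr euclid_norm0 ltNge ltW.
have [J [y [w [Ly w_ge0 p_x0 p_le]]]] :=
  newton_potential hn mK h_gt0 A_gt0 B_gt0 muK
  Kx0 nLx0 mL LE c4 eps_gt0 eps4 muL tau_gt0 (Hint _ eps_d).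
(* The largest factor for which [p <= C * H] keeps the barrier at least [a + eta] next to the poles;
   at [x0] it gives [l * p >= 2 * eta]. *)
pose l := (b - a) / (C * H).
have CH_gt0 : 0 < C * H by exact: mulr_gt0.
have l_gt0 : 0 < l by rewrite divr_gt0 ?subr_gt0.
have ball_r x : euclid_norm (x - x0) <= 4 * eps -> euclid_norm (x - x0) < r.
  by move=> xx0; apply: le_lt_trans xx0 _; lra.
have eps4_gt0 : 0 < 4 * eps by rewrite mulr_gt0.
have : (v x0 <= (b + eta - l * \sum_(i < J) w i *
    (newton n (euclid_norm (x0 - y i)) - newton n (3 * eps)))%:E)%E; last first.
  rewrite vb lee_fin; move: p_x0; rewrite -/H -/c';
    set p := \sum_(_ < _) _ => pH.
  have : 2 * eta <= l * p.
    apply: le_trans (ler_wpM2l (ltW l_gt0) pH).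
    rewrite le_eqVlt; apply/orP; left; apply/eqP.
    by rewrite /eta /l; field; rewrite !gt_eqF.
  lra.
apply: (subharmonic_le_newton_potential hn subv eps4_gt0 tau_gt0 _
  (fun i => x0_far _ (Ly i))).
- move=> x /= /ball_r xr; apply: r3P; exact: lt_le_trans xr rr3.
(* On the sphere of radius [4 * eps] every pole is at distance at least [3 * eps], so the normalised
   potential is nonpositive and the barrier at least [b + eta]. *)
- move=> x xx0; have : (v x < (b + eta)%:E)%E.
    apply: r2P; apply: lt_le_trans rr2; apply: ball_r; by rewrite xx0.
  move=> /ltW/le_trans; apply; rewrite lee_fin lerBrDr gerDl.
  rewrite pmulr_rle0//; apply: sumr_le0 => i _.
  rewrite mulr_ge0_le0// subr_le0; apply: newton_le; rewrite ?mulr_gt0//.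
  have [_ yx0] := LE _ (Ly i); rewrite /eball/= in yx0.
  have := euclid_dist_triangle (y i) x x0; rewrite xx0; lra.
- move=> x i xx0 xi xy; apply: le_trans (ltW (near_L _ _ (Ly i) xi)) _.
  rewrite lee_fin.
  have := p_le x i xy xi; rewrite -/C -/H; set p := \sum_(_ < _) _ => pCH.
  have : l * p <= b - a.
    by rewrite /l mulrAC ler_pdivrMr// ler_wpM2l// subr_ge0 ltW.
  lra.
Qed.
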